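(* Let $\Omega=(0,1)^2$, let $\Omega_h$ be the uniform mesh of $\Omega$ into squares of side $h$, and consider the $Q^1$ finite element scheme with mixed quadrature (described in the context) for the elliptic problem $-\nabla\cdot(\mathbf a\nabla u)+cu=f$ in $\Omega$, $u=g$ on $\partial\Omega$, where $\mathbf a$ is symmetric and uniformly positive definite and $c\ge 0$. For each $e\in\Omega_h$ let $\bar{\mathbf a}_e=(\bar a_e^{ij})$ be either the average of $\mathbf a$ over $e$ or the value of $\mathbf a$ at the center of $e$. Assume that for all $e\in\Omega_h$, $$|\bar a^{12}_e|\le \min\{\bar a^{11}_e,\bar a^{22}_e\}.$$ Suppose the quadrature parameters on each element $e$ are chosen as $$\lambda^1_e,\ \lambda^2_e\in\left(\frac{|\bar a^{11}_e-\bar a^{22}_e|}{\bar a^{11}_e+\bar a^{22}_e},\ 1-\frac{2|\bar a^{12}_e|}{\bar a^{11}_e+\bar a^{22}_e}\right],$$ where, in the case $|\bar a^{12}_e|=\min\{\bar a^{11}_e,\bar a^{22}_e\}$, this is understood to mean $\lambda^1_e=\lambda^2_e=1-\frac{2|\bar a^{12}_e|}{\bar a^{11}_e+\bar a^{22}_e}$. Then the stiffness matrix $A=(\mathcal A_h(\varphi_j,\varphi_i))_{i,j=1}^{N_h}$ and the matrix $\bar L_h$ are (nonsingular) $M$-matrices, and the finite difference operator defined by $\bar L_h$ satisfies the discrete maximum principle: for every $\bar{\mathbf u}=(u_1,\dots,u_{N_h+N_h^\partial})^T$, $$(\bar L_h\bar{\mathbf u})_i\le 0\ \text{ for } 1\le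 i\le N_h\ \Longrightarrow\ \max_{1\le i\le N_h+N_h^\partial}u_i\le\max\Big\{0,\max_{N_h+1\le i\le N_h+N_h^\partial}u_i\Big\}.$$
   Context: The functions $\mathbf a:\bar\Omega\to\mathbb R^{2\times2}$, $c$, $f$, $g$ are sufficiently smooth. Mesh and basis: $\Omega_h$ is the uniform mesh of $\Omega$ into squares of side $h=1/n$; $V^h$ is the space of continuous functions on $\bar\Omega$ whose restriction to each $e\in\Omega_h$ is bilinear ($Q^1$). The mesh vertices inside $\Omega$ are $\mathbf x_1,\dots,\mathbf x_{N_h}$ (assume $N_h\ge1$), those on $\partial\Omega$ are $\mathbf x_{N_h+1},\dots,\mathbf x_{N_h+N_h^\partial}$; $\varphi_i\in V^h$ is the nodal basis, $\varphi_i(\mathbf x_j)=\delta_{ij}$. Mixed quadrature: for $\lambda\in[0,1]$ put $\omega_1(\lambda)=\omega_3(\lambda)=\lambda/2$, $\omega_2(\lambda)=1-\lambda$, and $\xi_1=0,\xi_2=\frac12,\xi_3=1$. For $\boldsymbol\lambda=(\lambda^1,\lambda^2)$ and $\hat K=[0,1]^2$, $$\int_{\hat K}\hat f\,d^h_{\boldsymbol\lambda}\hat{\mathbf x}:=\sum_{p=1}^3\sum_{q=1}^3\omega_p(\lambda^1)\omega_q(\lambda^2)\hat f(\xi_p,\xi_q).$$ For $e\in\Omega_h$ with $\mathbf F_e:\hat K\to e$ the map ''translate and scale by $h$'', $\int_e f\,d^h_{\boldsymbol\lambda}\mathbf x:=h^2\int_{\hat K}f\circ\mathbf F_e\,d^h_{\boldsymbol\lambda}\hat{\mathbf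 x}$ (one-sided values from $e$ are used for discontinuous integrands). $\int_e f\,d^h_1\mathbf x$ denotes the case $\boldsymbol\lambda=(1,1)$ (trapezoid rule in both directions). Scheme: $$\mathcal A_h(u_h,v_h)=\sum_{e\in\Omega_h}\left(\int_e(\bar{\mathbf a}_e\nabla u_h)\cdot\nabla v_h\,d^h_{\boldsymbol\lambda_e}\mathbf x+\int_e c\,u_hv_h\,d^h_1\mathbf x\right),\qquad \boldsymbol\lambda_e=(\lambda_e^1,\lambda_e^2).$$ Let $\bar A=(\mathcal A_h(\varphi_j,\varphi_i))$ with $1\le i\le N_h$, $1\le j\le N_h+N_h^\partial$, and let $M$ be the diagonal lumped mass matrix with $M_{ii}=\sum_e\int_e\varphi_i\,d^h_1\mathbf x$, $1\le i\le N_h$. The square matrix $\bar L_h$ of size $N_h+N_h^\partial$ is defined by $(\bar L_h\bar{\mathbf u})_i=(M^{-1}\bar A\bar{\mathbf u})_i$ for $1\le i\le N_h$ and $(\bar L_h\bar{\mathbf u})_i=u_i$ for $N_h+1\le i\le N_h+N_h^\partial$. The scheme is $\bar L_h\bar{\mathbf u}=\bar{\mathbf f}$ with $\bar f_i=f(\mathbf x_i)$ at interior and $\bar f_i=g(\mathbf x_i)$ at boundary vertices. A nonsingular $M$-matrix is a real square matrix with nonpositive off-diagonal entries that is invertible with entrywise nonnegative inverse. *)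

(* Defs.v *)
From HB Require Import structures.
From mathcomp Require Import all_boot all_order all_algebra.
From mathcomp Require Import all_classical all_reals all_analysis.

Set Implicit Arguments.
Unset Strict Implicit.
Unset Printing Implicit Defensive.

Import Order.TTheory GRing.Theory Num.Theory.
Import numFieldNormedType.Exports.

Local Open Scope classical_set_scope.
Local Open Scope ring_scope.

(* Points of the plane are pairs; the indices 0, 1 : 'I_2 play the role of the
   mathematical indices 1, 2. *)

Section Coefficients.
Context {R : realType}.

Definition Omega : set (R * R) := `]0, 1[ `*` `]0, 1[.
Definition Omega_closed : set (R * R) := `[0, 1] `*` `[0, 1].
Definition Omega_boundary : set (R * R) := Omega_closed `\` Omega.

Definition unif_posdef (a : R * R -> 'M[R]_2) : Prop :=
  exists2 theta : R, 0 < theta &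
    forall x, Omega_closed x -> forall v : 'cV[R]_2,
      theta * (\sum_i v i 0 ^+ 2) <= (v^T *m a x *m v) 0 0.

Definition partial1 (u : R * R -> R) (x : R * R) : R :=
  derive1 (fun s : R => u (s, x.2)) x.1.
Definition partial2 (u : R * R -> R) (x : R * R) : R :=
  derive1 (fun s : R => u (x.1, s)) x.2.
Definition grad (u : R * R -> R) (x : R * R) : 'cV[R]_2 :=
  \col_i (if i == 0 then partial1 u x else partial2 u x).

Definition dotv (v w : 'cV[R]_2) : R := \sum_i v i 0 * w i 0.

End Coefficients.

Section Mesh.
Context {R : realType} (n : nat).

Definition mesh_size : R := n%:R^-1.

(* The element e = (i, j) is [i h, (i + 1) h] x [j h, (j + 1) h]. *)
Definition elem : Type := ('I_n * 'I_n)%type.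

Definition elem_map (e : elem) (x : R * R) : R * R :=
  ((e.1%:R + x.1) * mesh_size, (e.2%:R + x.2) * mesh_size).
Definition elem_set (e : elem) : set (R * R) := elem_map e @` Omega_closed.
Definition elem_center (e : elem) : R * R := elem_map e (2^-1, 2^-1).

Definition elem_average (a : R * R -> 'M[R]_2) (e : elem) : 'M[R]_2 :=
  \matrix_(i, j)
    ((\int[(@lebesgue_measure R \x @lebesgue_measure R)%E]_(x in elem_set e)
        (a x i j)) / mesh_size ^+ 2).

Definition mesh_vertex (p : 'I_n.+1 * 'I_n.+1) : R * R :=
  (p.1%:R * mesh_size, p.2%:R * mesh_size).

(* Nh interior vertices are numbered first, followed by Nb boundary vertices;
   the numbering is otherwise arbitrary. *)
Definition vertex_numbering (Nh Nb : nat) (x : 'I_(Nh + Nb) -> R * R) : Prop :=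
  [/\ injective x,
      range x = range mesh_vertex,
      forall i : 'I_Nh, Omega (x (lshift Nb i)) &
      forall i : 'I_Nb, Omega_boundary (x (rshift Nh i))].

(* Elements of V^h are functions on the closed square; their values outside it
   are irrelevant. *)
Definition Vh : set (R * R -> R) :=
  [set v | {within Omega_closed, continuous v} /\
    forall e : elem, exists c0 c1 c2 c3 : R, forall x, elem_set e x ->
      v x = c0 + c1 * x.1 + c2 * x.2 + c3 * (x.1 * x.2)].

Definition nodal_basis (N : nat) (x : 'I_N -> R * R)
    (phi : 'I_N -> R * R -> R) : Prop :=
  (forall i, Vh (phi i)) /\ (forall i j, phi i (x j) = (i == j)%:R).

(* One-sided value of f at a point x of e: the limit from the interior of e. *)
Definition elem_trace (e : elem) (f : R * R -> R) (x : R * R) : R :=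
  lim (f y @[y --> within (interior (elem_set e)) (nbhs x)]).

Definition quad_weight (lam : R) (p : 'I_3) : R :=
  [:: lam / 2; 1 - lam; lam / 2]`_p.
Definition quad_node (p : 'I_3) : R := [:: 0; 2^-1; 1]`_p.

Definition ref_quad (lam : R * R) (f : R * R -> R) : R :=
  \sum_(p < 3) \sum_(q < 3)
    quad_weight lam.1 p * quad_weight lam.2 q * f (quad_node p, quad_node q).

Definition elem_quad (e : elem) (lam : R * R) (f : R * R -> R) : R :=
  mesh_size ^+ 2 * ref_quad lam (elem_trace e f \o elem_map e).

Definition Ah (abar : elem -> 'M[R]_2) (c : R * R -> R) (lam : elem -> R * R)
    (u v : R * R -> R) : R :=
  \sum_(e : elem)
    (elem_quad e (lam e) (fun x => dotv (abar e *m grad u x) (grad v x))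
     + elem_quad e (1, 1) (fun x => c x * u x * v x)).

Section Matrices.
Variables (abar : elem -> 'M[R]_2) (c : R * R -> R) (lam : elem -> R * R).
Variables (Nh Nb : nat) (phi : 'I_(Nh + Nb) -> R * R -> R).

Definition stiffness : 'M[R]_Nh :=
  \matrix_(i, j) Ah abar c lam (phi (lshift Nb j)) (phi (lshift Nb i)).

Definition stiffness_bar : 'M[R]_(Nh, Nh + Nb) :=
  \matrix_(i, j) Ah abar c lam (phi j) (phi (lshift Nb i)).

Definition lumped_mass : 'M[R]_Nh :=
  diag_mx (\row_i \sum_(e : elem) elem_quad e (1, 1) (phi (lshift Nb i))).

Definition Lbar : 'M[R]_(Nh + Nb) :=
  col_mx (invmx lumped_mass *m stiffness_bar) (row_mx 0 1%:M).

End Matrices.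

End Mesh.

Section MMatrix.
Context {R : realType}.

Definition nonsingular_Mmatrix (m : nat) (B : 'M[R]_m) : Prop :=
  [/\ forall i j, i != j -> B i j <= 0,
      B \in unitmx &
      forall i j, 0 <= invmx B i j].

(* The maximal entry of u when 0 < m. *)
Definition max_entry (m : nat) (u : 'cV[R]_m) : R :=
  sup (range (fun i => u i 0)).

(* usubmx and dsubmx extract the interior and the boundary entries. *)
Definition discrete_max_principle (Nh Nb : nat) (L : 'M[R]_(Nh + Nb)) : Prop :=
  forall u : 'cV[R]_(Nh + Nb),
    (forall i : 'I_Nh, usubmx (L *m u) i 0 <= 0) ->
    max_entry u <= Num.max 0 (max_entry (dsubmx u)).

End MMatrix.

(* Main.v *)
(* On each element the quadrature form is a sum, over the six pairs of corners,
   of w (u(s) - u(t)) (v(s) - v(t)).  The bounds on the quadrature parameters make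
   all weights nonnegative and prevent the weights of the horizontal and of the
   vertical edges from both vanishing.  Hence the rows of
   the matrix have nonpositive off-diagonal entries and nonnegative sums, and
   the element north-east of an interior vertex couples it strictly to a vertex
   with a larger value of x + y; a maximum therefore propagates along
   increasing x + y until it reaches the boundary, even if the matrix is not
   irreducible.  Monotonicity of the matrices follows from this maximum
   principle. *)
Require Import Defs.
From mathcomp Require Import all_boot all_order all_algebra.
From mathcomp Require Import all_classical all_reals all_analysis.
From mathcomp Require Import ring lra.

Set Implicit Arguments.
Unset Strict Implicit.
Unset Printing Implicit Defensive.

Import Order.TTheory GRing.Theory Num.Theory.
Import numFieldNormedType.Exports.

Local Open Scope classical_set_scope.
Local Open Scope ring_scope.

(** * Monotone matrices *)

(** The hypothesis applied to [w] and [- w] makes the kernel of [B] trivial. Applied to minus a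
    column of the inverse, which [B] sends to minus a unit vector, it gives the signs of that
    column. *)
Lemma inverse_nonneg_of_monotone (R : realType) (m : nat) (B : 'M[R]_m) :
  (forall w : 'cV[R]_m, (forall i, (B *m w) i 0 <= 0) -> forall i, w i 0 <= 0) ->
  B \in unitmx /\ forall i j, 0 <= invmx B i j.
Proof.
move=> Bmono.
have Bunit : B \in unitmx.
  (* [kermx] is the left kernel, hence the passage to the transpose. *)
  rewrite -unitmx_tr -row_free_unit -kermx_eq0.
  apply/eqP/row_matrixP => k; rewrite row0.
  have : row k (kermx B^T) *m B^T = 0 by rewrite -row_mul mulmx_ker row0.
  move: (row k _) => r rB.
  have Br : B *m r^T = 0 by apply: trmx_inj; rewrite trmx_mul trmxK trmx0.
  have rT0 : forall w : 'cV[R]_m, B *m w = 0 -> forall i, w i 0 <= 0.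
    by move=> w Bw; apply: Bmono => i; rewrite Bw mxE.
  apply/rowP => i; rewrite [RHS]mxE; apply: le_anti.
  have := rT0 _ Br i; rewrite mxE => ->.
  have := rT0 (- r^T) _ i; rewrite mulmxN Br oppr0 => /(_ erefl).
  by rewrite !mxE oppr_le0.
split=> // i j; rewrite -oppr_le0.
have := Bmono (- col j (invmx B)) _ i; rewrite !mxE; apply => {}i.
by rewrite mulmxN colE mulmxA -colE mulmxV// !mxE oppr_le0 ler0n.
Qed.

(* Among the points where u is maximal take one of largest r: at an interior
   index the row inequality forces every neighbour to be maximal as well, and
   one of them has a larger r. *)
Lemma maximum_principle_of_potential (R : realType) (Nh Nb : nat)
    (B : 'M[R]_(Nh, Nh + Nb)) (r : 'I_(Nh + Nb) -> R) (u : 'cV[R]_(Nh + Nb))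
    (m : R) :
  (forall i j, lshift Nb i != j -> B i j <= 0) ->
  (forall i, 0 <= \sum_j B i j) ->
  (forall i, exists2 j, B i j < 0 & r (lshift Nb i) < r j) ->
  (forall i, (B *m u) i 0 <= 0) ->
  0 <= m -> (forall i, u (rshift Nh i) 0 <= m) ->
  forall j, u j 0 <= m.
Proof.
move=> Boff Bsum Br Bu m0 ub j0.
case: (@arg_maxP _ _ _ j0 xpredT (fun j => u j 0) isT) => k _ kmax.
case: (@arg_maxP _ _ _ k (fun j => u j 0 == u k 0) r (eqxx _)) => j /eqP uj jmax.
apply: le_trans (kmax j0 isT) _; rewrite -uj.
have umax l : u l 0 <= u j 0 by rewrite uj; exact: kmax.
case: (splitP j) jmax umax uj => [i jE|i jE] jmax umax uj; last first.
  by have -> : j = rshift Nh i by apply: val_inj.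
have {}jE : j = lshift Nb i by apply: val_inj.
subst j; rewrite leNgt; apply/negP => um.
have [l Bl rl] := Br i.
have ul : u l 0 < u (lshift Nb i) 0.
  rewrite lt_neqAle umax andbT; apply/negP => /eqP ule.
  by have := jmax l; rewrite ule uj eqxx => /(_ isT) /=; rewrite leNgt rl.
(* Measured against the maximal value, every term is nonnegative and term [l] is positive. Since the
   row sum and the maximal value are nonnegative, [(B *m u) i 0] is then positive, a
   contradiction. *)
have : 0 < \sum_j B i j * (u j 0 - u (lshift Nb i) 0).
  rewrite (bigD1 l)//= ltr_wpDr//; last by rewrite nmulr_rgt0// subr_lt0.
  apply: sumr_ge0 => j _; have [<-|ij] := eqVneq (lshift Nb i) j.
    by rewrite subrr mulr0.
  by rewrite mulr_le0 ?Boff// subr_le0.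
under eq_bigr do rewrite mulrBr.
rewrite sumrB -mulr_suml subr_gt0 => lt.
have := Bu i; rewrite mxE leNgt => /negP; apply; apply: le_lt_trans lt.
by rewrite mulr_ge0 ?Bsum// (le_trans m0)// ltW.
Qed.

Lemma le_max_entry (R : realType) (m : nat) (u : 'cV[R]_m) (i : 'I_m) :
  u i 0 <= max_entry u.
Proof.
apply: ub_le_sup; last by exists i.
exists (\sum_j `|u j 0|) => _ [j _ <-].
by rewrite (bigD1 j)//= (le_trans (ler_norm _))// lerDl sumr_ge0.
Qed.

(** * Scaling of the interior rows and identity boundary rows *)

Section Scaled.
Variables (R : realType) (Nh Nb : nat) (d : 'rV[R]_Nh) (B : 'M[R]_(Nh, Nh + Nb)).
Hypothesis d_gt0 : forall i, 0 < d 0 i.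
Hypothesis Boff : forall i j, lshift Nb i != j -> B i j <= 0.

(** [Lbar] has this shape, with the lumped masses as [d] and [stiffness_bar] as [B]. *)
Let L : 'M[R]_(Nh + Nb) := col_mx (invmx (diag_mx d) *m B) (row_mx 0 1%:M).

Lemma mulmx_inv_diag (m : nat) (C : 'M[R]_(Nh, m)) i j :
  (invmx (diag_mx d) *m C) i j = (d 0 i)^-1 * C i j.
Proof.
have dinv : diag_mx d *m diag_mx (\row_k (d 0 k)^-1) = 1%:M.
  apply/matrixP => k l; rewrite mul_diag_mx !mxE; case: eqVneq => [->|_];
    rewrite ?mulr1n ?mulr0n ?mulfV ?gt_eqF ?mulr0//.
have [du _] := mulmx1_unit dinv.
have -> : invmx (diag_mx d) = diag_mx (\row_k (d 0 k)^-1).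
  by rewrite -[RHS](mulKmx du) dinv mulmx1.
by rewrite mul_diag_mx !mxE.
Qed.

Hypothesis Bsum : forall i, 0 <= \sum_j B i j.
Variable r : 'I_(Nh + Nb) -> R.
Hypothesis Br : forall i, exists2 j, B i j < 0 & r (lshift Nb i) < r j.

(** A positive diagonal scaling preserves the signs of the interior rows. The bound [m = 0] yields
    monotonicity of both matrices; the larger of 0 and the boundary maximum yields the discrete
    maximum principle. *)
Lemma le_of_mulmx_le0 (u : 'cV[R]_(Nh + Nb)) (m : R) :
  (forall i, usubmx (L *m u) i 0 <= 0) -> 0 <= m ->
  (forall i, u (rshift Nh i) 0 <= m) -> forall j, u j 0 <= m.
Proof.
move=> Lu; apply: maximum_principle_of_potential Boff Bsum Br _ => i.
have := Lu i; rewrite mul_col_mx col_mxKu -mulmxA mulmx_inv_diag.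
by rewrite pmulr_rle0// invr_gt0.
Qed.

Lemma dsubmx_mulmx (u : 'cV[R]_(Nh + Nb)) : dsubmx (L *m u) = dsubmx u.
Proof.
by rewrite mul_col_mx col_mxKd -{1}[u]vsubmxK mul_row_col mul0mx mul1mx add0r.
Qed.

Lemma Mmatrix_lsubmx : nonsingular_Mmatrix (lsubmx B).
Proof.
have mono (w : 'cV[R]_Nh) :
    (forall i, (lsubmx B *m w) i 0 <= 0) -> forall i, w i 0 <= 0.
  (* With zero boundary values, [B] acts on [u] as its interior block acts on [w]. *)
  move=> Bw i; pose u : 'cV[R]_(Nh + Nb) := col_mx w 0.
  have -> : w i 0 = u (lshift Nb i) 0 by rewrite col_mxEu.
  apply: (le_of_mulmx_le0 _ (lexx 0)) => k; last by rewrite col_mxEd mxE.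
  rewrite mul_col_mx col_mxKu -mulmxA mulmx_inv_diag pmulr_rle0 ?invr_gt0//.
  by rewrite -[B]hsubmxK mul_row_col mulmx0 addr0.
have [Bu Bi] := inverse_nonneg_of_monotone mono.
split=> // i j ij; rewrite mxE; apply: Boff.
by rewrite (inj_eq (@lshift_inj _ _)).
Qed.

Lemma Mmatrix_scaled : nonsingular_Mmatrix L.
Proof.
have mono (w : 'cV[R]_(Nh + Nb)) :
    (forall i, (L *m w) i 0 <= 0) -> forall i, w i 0 <= 0.
  move=> Lw; apply: (le_of_mulmx_le0 _ (lexx 0)) => i; first by rewrite mxE.
  by have := Lw (rshift Nh i); rewrite -[L *m w]vsubmxK col_mxEd dsubmx_mulmx mxE.
have [Lu Li] := inverse_nonneg_of_monotone mono.
split=> // i j; case: (split_ordP i) => k -> kj.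
  rewrite col_mxEu mulmx_inv_diag pmulr_rle0 ?invr_gt0//.
  exact: Boff.
rewrite col_mxEd; move: kj; case: (split_ordP j) => l -> kl.
  by rewrite row_mxEl mxE.
by rewrite row_mxEr mxE (negbTE (_ : k != l))//; apply: contraNneq kl => ->.
Qed.

Lemma discrete_max_principle_scaled : (0 < Nh)%N -> discrete_max_principle L.
Proof.
move=> Nh0 u Lu; apply: ge_sup.
  (* Bounding the supremum requires a nonempty range; an interior index provides a point of it. *)
  by exists (u (lshift Nb (Ordinal Nh0)) 0), (lshift Nb (Ordinal Nh0)).
move=> _ [j _ <-]; apply: (le_of_mulmx_le0 Lu) => [|i]; first by rewrite le_max lexx.
by rewrite le_max -[u]vsubmxK col_mxEd -{2}[u]vsubmxK col_mxKd le_max_entry orbT.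
Qed.

End Scaled.

(** * The averaged coefficient *)

(** The product sigma-algebra contains the rectangles, and an open set is the countable union of the
    boxes with rational endpoints that it contains. *)
Lemma open_measurable_prod (R : realType) (U : set (R * R)) :
  open U -> measurable U.
Proof.
move=> oU.
pose box (q : rat * rat * (rat * rat)) : set (R * R) :=
  `]ratr q.1.1, ratr q.1.2[ `*` `]ratr q.2.1, ratr q.2.2[.
have -> : U = \bigcup_(q in [set q | box q `<=` U]) box q.
  apply/seteqP; split=> [x Ux|x [q qU xq]]; last exact: qU.
  have : nbhs x U by exact: open_nbhs_nbhs.
  move=> /nbhs_ballP [e /= e0 eU].
  have rat_near (y : R) : exists q : rat * rat,
      [/\ y - e < ratr q.1, ratr q.1 < y, y < ratr q.2 & ratr q.2 < y + e].
    have [|p] := @rat_in_itvoo _ (y - e) y; first by rewrite gtrBl.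
    rewrite in_itv/= => /andP[p1 p2].
    have [|q] := @rat_in_itvoo _ y (y + e); first by rewrite ltrDl.
    by rewrite in_itv/= => /andP[q1 q2]; exists (p, q).
  have [q [q1 q2 q3 q4]] := rat_near x.1.
  have [r [r1 r2 r3 r4]] := rat_near x.2.
  exists (q, r); last by split; rewrite /= in_itv/=; apply/andP.
  move=> z [/= z1 z2]; apply: eU; move: z1 z2.
  rewrite !in_itv/= => /andP[? ?] /andP[? ?].
  by split; rewrite /ball/= ltr_norml; apply/andP; split; lra.
rewrite bigcup_mkcond; apply: countable_bigcupT_measurable => // q.
by case: ifPn => // _; apply: measurableX; exact: measurable_itv.
Qed.

Lemma lebesgue_measure_box (R : realType) (a b c d : R) : a <= b -> c <= d ->
  (@lebesgue_measure R \x @lebesgue_measure R)%E (`[a, b] `*` `[c, d])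
    = ((b - a) * (d - c))%:E.
Proof.
move=> ab cd; have itvE (u v : R) : u <= v -> lebesgue_measure `[u, v] = (v - u)%:E.
  by rewrite le_eqVlt lebesgue_measure_itv/= lte_fin => /predU1P[->|->//];
    rewrite ltxx subrr.
transitivity (@lebesgue_measure R `[a, b] * @lebesgue_measure R `[c, d])%E.
  by apply: product_measure1E; exact: measurable_itv.
by rewrite !itvE.
Qed.

(** Preimages of open intervals are relatively open, hence measurable, and compactness of the box
    bounds [f]. *)
Lemma continuous_integrable_prod (R : realType) (a b c d : R) (f : R * R -> R) :
  let D : set (R * R) := `[a, b] `*` `[c, d] in a <= b -> c <= d ->
  {within D, continuous f} ->
  (@lebesgue_measure R \x @lebesgue_measure R)%E.-integrable D (EFin \o f).
Proof.
move=> D ab cd cf; have mD : measurable D by apply: measurableX; exact: measurable_itv.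
apply: measurable_bounded_integrable => //.
- by rewrite [X in (X < _)%E](lebesgue_measure_box ab cd) ltry.
- apply: (measurability _ (measurable_realfun.RGenOpens.measurableE R)).
  move=> _ [_ [u [v ->] <-]].
  have /open_subspaceP[V oV VD] : open ((f : subspace D -> R) @^-1` `]u, v[).
    by move/continuousP : cf; apply; exact: interval_open.
  rewrite setIC -VD; apply: measurableI => //; exact: open_measurable_prod.
- have cD : compact D by apply: compact_setX; exact: segment_compact.
  have /compact_bounded[M [_ mrt]] := continuous_compact cf cD.
  by exists M; split; rewrite ?num_real // => ? ? ? ?; exact: mrt.
Qed.

Lemma elem_setE (R : realType) (n : nat) (e : elem n) : (0 < n)%N ->
  @elem_set R n e = `[e.1%:R / n%:R, e.1.+1%:R / n%:R] `*` `[e.2%:R / n%:R, e.2.+1%:R / n%:R].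
Proof.
move=> n0; have n0' : 0 < n%:R :> R by rewrite ltr0n.
have nN0 : n%:R != 0 :> R by rewrite gt_eqF.
apply/seteqP; split=> [_ [x [x1 x2] <-]|x [/= x1 x2]].
  move: x1 x2; rewrite /= !in_itv/= /mesh_size.
  move=> /andP[? ?] /andP[? ?]; rewrite !ler_pM2r ?invr_gt0// -!natr1.
  by rewrite !lerDl !lerD2l; split; apply/andP; split.
move: x1 x2; rewrite !in_itv/= !ler_pdivrMr// !ler_pdivlMr// -!natr1.
move=> /andP[? ?] /andP[? ?].
exists (x.1 * n%:R - e.1%:R, x.2 * n%:R - e.2%:R).
  by split; rewrite /= in_itv/=; apply/andP; split; lra.
rewrite [RHS]surjective_pairing /elem_map /mesh_size/=; by congr (_, _); field.
Qed.

Lemma elem_set_sub (R : realType) (n : nat) (e : elem n) :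
  @elem_set R n e `<=` Omega_closed.
Proof.
move=> _ [x [x1 x2] <-]; move: x1 x2; rewrite /= !in_itv/=.
move=> /andP[x10 x11] /andP[x20 x21]; rewrite /elem_map /mesh_size.
have n0 : (0 < n)%N by apply: leq_trans (ltn_ord e.1).
have nR : 0 < n%:R :> R by rewrite ltr0n.
have bd (i : 'I_n) (t : R) : 0 <= t -> t <= 1 -> 0 <= (i%:R + t) / n%:R <= 1.
  move=> t0 t1; rewrite divr_ge0 ?addr_ge0//= ler_pdivrMr// mul1r.
  by rewrite (le_trans (lerD (lexx _) t1))// natr1 ler_nat.
by split; rewrite /= in_itv/= bd.
Qed.

Lemma entry_continuous (R : realType) (D : set (R * R)) (a : R * R -> 'M[R]_2) i j :
  {within D, continuous a} -> {within D, continuous (fun x => a x i j)}.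
Proof.
move=> /subspace_continuousP ca; apply/subspace_continuousP => x Dx.
exact: (cvg_comp _ _ (ca x Dx) (@coord_continuous R 2 2 i j (a x))).
Qed.

Lemma quad_form_entries (R : comNzRingType) (M : 'M[R]_2) (s t : R) :
  let v : 'cV[R]_2 := \col_i (if i == 0 then s else t) in
  (v^T *m M *m v) 0 0 =
    s ^+ 2 * M 0 0 + s * t * (M 0 1 + M 1 0) + t ^+ 2 * M 1 1.
Proof.
rewrite /= -mulmxA mxE !big_ord_recl big_ord0 !mxE !big_ord_recl !big_ord0 !mxE/=.
have -> : lift ord0 ord0 = 1 :> 'I_2 by apply: val_inj.
ring.
Qed.

(** For fixed [s] and [t] the quadratic form is linear in the matrix entries, so a pointwise lower
    bound can be integrated and divided by the measure. *)
Lemma average_form (d : measure_display) (T : measurableType d) (R : realType)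
    (mu : {measure set T -> \bar R}) (E : set T) (m : R) (a : T -> 'M[R]_2)
    (theta s t : R) :
  measurable E -> mu E = m%:E -> 0 < m ->
  (forall i j, mu.-integrable E (EFin \o (fun x => a x i j))) ->
  (forall x, E x ->
    theta <= s ^+ 2 * a x 0 0 + s * t * (a x 0 1 + a x 1 0) + t ^+ 2 * a x 1 1) ->
  let avg i j := (\int[mu]_(x in E) a x i j) / m in
  theta <= s ^+ 2 * avg 0 0 + s * t * (avg 0 1 + avg 1 0) + t ^+ 2 * avg 1 1.
Proof.
move=> mE muE m0 ci ath /=.
have Zi i j k : mu.-integrable E (EFin \o (fun x => k * a x i j)).
  exact: (integrableZl mE k (ci i j)).
have Di f g : mu.-integrable E (EFin \o f) -> mu.-integrable E (EFin \o g) ->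
    mu.-integrable E (EFin \o (fun x => f x + g x)).
  by move=> fi gi; exact: (integrableD mE fi gi).
have : \int[mu]_(x in E) theta <= \int[mu]_(x in E)
   (s ^+ 2 * a x 0 0 + s * t * a x 0 1 + s * t * a x 1 0 + t ^+ 2 * a x 1 1).
  apply: le_Rintegral => //; last by move=> x /ath; rewrite mulrDr addrA.
  - apply: measurable_bounded_integrable => //; first by rewrite muE ltry.
    by exists `|theta|; split; rewrite ?num_real// => M /ltW ? y _.
  - by do 3 apply: (Di) => //.
rewrite Rintegral_cst// muE/= !RintegralD// ?RintegralZl//; do ?apply: (Di) => //.
rewrite -ler_pdivlMr// => /le_trans; apply.
by rewrite le_eqVlt; apply/orP; left; apply/eqP; field; rewrite gt_eqF.
Qed.

Lemma elem_average_form (R : realType) (n : nat) (a : R * R -> 'M[R]_2)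
    (e : elem n) (theta s t : R) :
  {within Omega_closed, continuous a} ->
  (forall x, Omega_closed x ->
    theta <= s ^+ 2 * a x 0 0 + s * t * (a x 0 1 + a x 1 0) + t ^+ 2 * a x 1 1) ->
  theta <= s ^+ 2 * elem_average a e 0 0
    + s * t * (elem_average a e 0 1 + elem_average a e 1 0)
    + t ^+ 2 * elem_average a e 1 1.
Proof.
move=> ca ath; have n0 : (0 < n)%N by apply: leq_trans (ltn_ord e.1).
have nR : 0 < n%:R :> R by rewrite ltr0n.
have side (i : 'I_n) : i%:R / n%:R <= i.+1%:R / n%:R :> R.
  by rewrite ler_pM2r ?invr_gt0// ler_nat.
rewrite !mxE; apply: average_form.
- by rewrite elem_setE//; apply: measurableX; exact: measurable_itv.
- rewrite elem_setE// [LHS]lebesgue_measure_box//.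
  by rewrite -!mulrBl -!natr1 !(addrC _ 1) !addrK !mul1r /mesh_size expr2.
- by rewrite exprn_gt0// invr_gt0.
- move=> i j.
  have := continuous_subspaceW (@elem_set_sub R n e) (@entry_continuous _ _ _ i j ca).
  by rewrite elem_setE//; exact: continuous_integrable_prod.
- by move=> x /elem_set_sub; exact: ath.
Qed.

(** Symmetry and uniform positivity pass to the average and to the center value alike. The strict
    last bound is what makes the upper end of the parameter interval positive. *)
Lemma elem_coeff_form (R : realType) (n : nat) (a : R * R -> 'M[R]_2)
    (abar : 'M[R]_2) (e : elem n) :
  {within Omega_closed, continuous a} ->
  (forall x, Omega_closed x -> (a x)^T = a x) -> unif_posdef a ->
  abar = elem_average a e \/ abar = a (elem_center e) ->
  [/\ abar 1 0 = abar 0 1, 0 < abar 0 0, 0 < abar 1 1 &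
      2 * `|abar 0 1| < abar 0 0 + abar 1 1].
Proof.
move=> ca asym [theta theta0 apos] abarE.
have sub := @elem_set_sub R n e.
have form s t : theta * (s ^+ 2 + t ^+ 2)
    <= s ^+ 2 * abar 0 0 + s * t * (abar 0 1 + abar 1 0) + t ^+ 2 * abar 1 1.
  have ath x : Omega_closed x -> theta * (s ^+ 2 + t ^+ 2)
      <= s ^+ 2 * a x 0 0 + s * t * (a x 0 1 + a x 1 0) + t ^+ 2 * a x 1 1.
    move=> /apos /(_ (\col_i (if i == 0 then s else t))).
    by rewrite quad_form_entries !big_ord_recl big_ord0 !mxE/= addr0.
  case: abarE => ->; first exact: elem_average_form.
  by apply: ath; apply: sub; exists (2^-1, 2^-1) => //; split; rewrite /= in_itv/=; apply/andP; split; lra.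
have sym : abar 1 0 = abar 0 1.
  have sx x : Omega_closed x -> a x 1 0 = a x 0 1.
    by move=> /asym /matrixP /(_ 0 1); rewrite mxE.
  case: abarE => ->; last first.
    by apply: sx; apply: sub; exists (2^-1, 2^-1) => //; split; rewrite /= in_itv/=; apply/andP; split; lra.
  rewrite !mxE; congr (_ / _); apply: eq_Rintegral => x.
  by rewrite inE => /sub /sx.
(* The unit vectors give the diagonal entries their sign; the vectors (1,1) and (1,-1) bound the
   off-diagonal entry from both sides. *)
have := form 1 0; have := form 0 1; have := form 1 1; have := form 1 (-1).
rewrite sym => f1 f2 f3 f4; split=> //; [nra..|].
by case: (ler0P (abar 0 1)) => ?; nra.
Qed.
(** * One-sided traces and quadrature *)

(** Quadrature nodes may lie on the boundary of [e]; this makes the filter in [elem_trace] proper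
    there, so that the one-sided limit is unique. *)
Lemma closure_interior_elem (R : realType) (n : nat) (e : elem n) (xi : R * R) :
  Omega_closed xi -> closure (interior (elem_set e)) (elem_map e xi).
Proof.
move=> [/= x1 x2]; move: x1 x2; rewrite !in_itv/= => /andP[x10 x11] /andP[x20 x21] B.
have n0 : (0 < n)%N by apply: leq_trans (ltn_ord e.1).
have nR : 0 < n%:R :> R by rewrite ltr0n.
move=> /nbhs_ballP[eps /= eps0 epsB].
have [t [t0 t1 te]] : exists t : R, [/\ 0 < t, t < 1 & t < eps].
  exists (Num.min 2^-1 (eps / 2)).
  by split; rewrite ?lt_min ?gt_min; [apply/andP|apply/orP; left|apply/orP; right]; try split; lra.
(* [mid] moves a coordinate the fraction [t] of the way to 1/2. It lands in the open unit interval
   because [0 < t < 1], and within [eps] after scaling because [t < eps] and the mesh size is at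
   most 1. *)
pose mid (s : R) := s + t * (2^-1 - s).
exists (elem_map e (mid xi.1, mid xi.2)); split; last first.
  apply: epsB; have near_mid (i : 'I_n) (s : R) : 0 <= s -> s <= 1 ->
      `|(i%:R + s) * mesh_size n - (i%:R + mid s) * mesh_size n| < eps.
    move=> s0 s1; rewrite -mulrBl normrM [X in _ * X]ger0_norm ?invr_ge0 ?ler0n//.
    rewrite ltr_pdivrMr// (@lt_le_trans _ _ (eps * 1))//; last first.
      by rewrite ler_pM2l// ler1n.
    by rewrite /mid ltr_norml; apply/andP; split; nra.
  by split; rewrite /ball/=; apply: near_mid.
have in_mid (i : 'I_n) (s : R) : 0 <= s -> s <= 1 ->
    (i%:R + mid s) * mesh_size n \in `]i%:R / n%:R, i.+1%:R / n%:R[.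
  move=> s0 s1; rewrite in_itv/= /mesh_size !ltr_pM2r ?invr_gt0//.
  by rewrite -natr1 ltrDl ltrD2l /mid; apply/andP; split; nra.
rewrite /interior/= elem_setE//.
exists (`]e.1%:R / n%:R, e.1.+1%:R / n%:R[%classic,
        `]e.2%:R / n%:R, e.2.+1%:R / n%:R[%classic).
  by split; apply: near_in_itvoo; apply: in_mid.
move=> y [/= y1 y2]; move: y1 y2; rewrite !in_itv/=.
by move=> /andP[/ltW -> /ltW ->] /andP[/ltW -> /ltW ->].
Qed.

Lemma elem_trace_lim (R : realType) (n : nat) (e : elem n) (f : R * R -> R)
    (xi : R * R) (l : R) : Omega_closed xi ->
  f y @[y --> within (interior (elem_set e)) (nbhs (elem_map e xi))] --> l ->
  elem_trace e f (elem_map e xi) = l.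
Proof.
move=> /closure_interior_elem/within_nbhs_proper prp fl.
exact: (cvg_lim (@Rhausdorff R)).
Qed.

Lemma elem_trace_continuous (R : realType) (n : nat) (e : elem n)
    (f : R * R -> R) (xi : R * R) :
  {within Omega_closed, continuous f} -> Omega_closed xi ->
  elem_trace e f (elem_map e xi) = f (elem_map e xi).
Proof.
move=> /subspace_continuousP cf xi01; apply: elem_trace_lim => //.
have sub := @elem_set_sub R n e.
have eO : Omega_closed (elem_map e xi) by apply: sub; exists xi.
apply: cvg_trans (cf _ eO); apply: cvg_fmap2; apply: within_subset => y /interior_subset.
exact: sub.
Qed.

(** * Bilinear functions and the quadrature form on one element *)

Definition bilinear (R : realType) (k0 k1 k2 k3 : R) (x : R * R) : R :=
  k0 + k1 * x.1 + k2 * x.2 + k3 * (x.1 * x.2).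

(** Derivatives are local, so agreement with the bilinear formula near [y] along both coordinate
    lines suffices. On the boundary of an element [u] may switch to another formula, hence the
    restriction to interior points. *)
Lemma grad_bilinear (R : realType) (D : set (R * R)) (u : R * R -> R)
    (k0 k1 k2 k3 : R) (y : R * R) :
  (forall x, D x -> u x = bilinear k0 k1 k2 k3 x) -> interior D y ->
  grad u y = \col_i (if i == 0 then k1 + k3 * y.2 else k2 + k3 * y.1).
Proof.
have der p q s : derive1 (fun t : R => p + q * t) s = q.
  by rewrite derive1E; apply: derive_val; apply: is_derive_eq; rewrite add0r mul1r [LHS]mulr1.
move=> uE [[A B] /= [nA nB] ABD]; apply/colP => i; rewrite !mxE.
case: ifP => _.
  rewrite -[RHS](der (k0 + k2 * y.2) _ y.1) /partial1 !derive1E.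
  apply: near_eq_derive; near=> s; rewrite uE /bilinear /=; first by ring.
  by apply: ABD; split => /=; [near: s|exact: nbhs_singleton].
rewrite -[RHS](der (k0 + k1 * y.1) _ y.2) /partial2 !derive1E.
apply: near_eq_derive; near=> s; rewrite uE /bilinear /=; first by ring.
by apply: ABD; split => /=; [exact: nbhs_singleton|near: s].
Unshelve. all: end_near. Qed.

Lemma sum3E (R : realType) (F : 'I_3 -> R) :
  \sum_p F p = F 0 + F 1 + F (inord 2).
Proof.
rewrite !big_ord_recl big_ord0 addr0 addrA.
by congr (_ + F _ + F _); apply: val_inj; rewrite /= ?inordK.
Qed.

Lemma ref_quadE (R : realType) (lam : R * R) (f : R * R -> R) :
  ref_quad lam f =
    lam.1 / 2 * (lam.2 / 2 * f (0, 0) + (1 - lam.2) * f (0, 2^-1) + lam.2 / 2 * f (0, 1))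
    + (1 - lam.1) * (lam.2 / 2 * f (2^-1, 0) + (1 - lam.2) * f (2^-1, 2^-1)
        + lam.2 / 2 * f (2^-1, 1))
    + lam.1 / 2 * (lam.2 / 2 * f (1, 0) + (1 - lam.2) * f (1, 2^-1) + lam.2 / 2 * f (1, 1)).
Proof.
by rewrite /ref_quad !sum3E /quad_weight /quad_node /= !inordK//=; ring.
Qed.

Definition corner_sum (R : realType) (f : R * R -> R) : R :=
  f (0, 0) + f (0, 1) + f (1, 0) + f (1, 1).

(* The trapezoid weights vanish at the midpoints. *)
Lemma elem_quad_trapezoid (R : realType) (n : nat) (e : elem n) (f : R * R -> R) :
  {within Omega_closed, continuous f} ->
  elem_quad e (1, 1) f = mesh_size n ^+ 2 / 4 * corner_sum (f \o elem_map e).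
Proof.
move=> cf; rewrite /corner_sum /elem_quad ref_quadE /=.
rewrite !elem_trace_continuous//; first by field.
all: by split; rewrite /= in_itv/=; lra.
Qed.

(* The couplings of the quadrature on the horizontal edges, on the vertical
   edges, on the diagonal (0,0)-(1,1) and on the diagonal (0,1)-(1,0). *)
Definition wH (R : realType) (A : 'M[R]_2) (lam : R * R) : R :=
  (A 0 0 * (1 + lam.2) - A 1 1 * (1 - lam.1)) / 4.
Definition wV (R : realType) (A : 'M[R]_2) (lam : R * R) : R :=
  (A 1 1 * (1 + lam.1) - A 0 0 * (1 - lam.2)) / 4.
Definition wD (R : realType) (A : 'M[R]_2) (lam : R * R) : R :=
  (A 0 0 * (1 - lam.2) + A 1 1 * (1 - lam.1)) / 4 + A 0 1 / 2.
Definition wA (R : realType) (A : 'M[R]_2) (lam : R * R) : R :=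
  (A 0 0 * (1 - lam.2) + A 1 1 * (1 - lam.1)) / 4 - A 0 1 / 2.

Definition edge_form (R : realType) (A : 'M[R]_2) (lam : R * R)
    (p q : R * R -> R) : R :=
  let d s t := (p s - p t) * (q s - q t) in
  wH A lam * (d (1, 0) (0, 0) + d (1, 1) (0, 1))
  + wV A lam * (d (0, 1) (0, 0) + d (1, 1) (1, 0))
  + wD A lam * d (1, 1) (0, 0) + wA A lam * d (0, 1) (1, 0).

(** Inside [e] the integrand is the polynomial [P], so the nine traces are values of [P], and both
    sides become explicit expressions in the bilinear coefficients. The area factor cancels the
    scaling of the two gradients, which is why the weights do not involve the mesh size. *)
Lemma elem_quad_grad (R : realType) (n : nat) (e : elem n) (A : 'M[R]_2)
    (lam : R * R) (u v : R * R -> R) :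
  A 1 0 = A 0 1 -> Vh n u -> Vh n v ->
  elem_quad e lam (fun x => dotv (A *m grad u x) (grad v x)) =
    edge_form A lam (u \o elem_map e) (v \o elem_map e).
Proof.
move=> sym [_ /(_ e)[k0 [k1 [k2 [k3 uE]]]]] [_ /(_ e)[l0 [l1 [l2 [l3 vE]]]]].
have n0 : (0 < n)%N by apply: leq_trans (ltn_ord e.1).
have nR : n%:R != 0 :> R by rewrite pnatr_eq0 -lt0n.
pose P (x : R * R) : R :=
  (A 0 0 * (k1 + k3 * x.2) + A 0 1 * (k2 + k3 * x.1)) * (l1 + l3 * x.2)
  + (A 0 1 * (k1 + k3 * x.2) + A 1 1 * (k2 + k3 * x.1)) * (l2 + l3 * x.1).
have cP x : P y @[y --> nbhs x] --> P x.
  have c1 : (y : R * R).1 @[y --> nbhs x] --> x.1 by exact: cvg_fst.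
  have c2 : (y : R * R).2 @[y --> nbhs x] --> x.2 by exact: cvg_snd.
  have lin (f : R * R -> R) p q : f y @[y --> nbhs x] --> f x ->
      p + q * f y @[y --> nbhs x] --> p + q * f x.
    by move=> cf; apply: cvgD; [exact: cvg_cst|apply: cvgMr].
  by apply: cvgD; apply: cvgM; do ?[exact: lin]; apply: cvgD; apply: cvgMr; exact: lin.
have tr xi : Omega_closed xi ->
    elem_trace e (fun x => dotv (A *m grad u x) (grad v x)) (elem_map e xi)
    = P (elem_map e xi).
  move=> xi01; apply: elem_trace_lim => //.
  apply: cvg_trans (cvg_within_filter _ (cP _)); apply: fmap_within_eq => x.
  rewrite inE => xin; rewrite (grad_bilinear uE xin) (grad_bilinear vE xin).
  rewrite /dotv !big_ord_recl big_ord0 !mxE !big_ord_recl !big_ord0 !mxE/=.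
  have -> : lift ord0 ord0 = 1 :> 'I_2 by apply: val_inj.
  by rewrite sym /P; ring.
have in01 (s t : R) : 0 <= s <= 1 -> 0 <= t <= 1 -> Omega_closed (s, t).
  by split; rewrite /= in_itv.
have h0 : 0 <= (0 : R) <= 1 by lra.
have h1 : 0 <= (1 : R) <= 1 by lra.
have hh : 0 <= (2^-1 : R) <= 1 by lra.
have uF xi : Omega_closed xi -> u (elem_map e xi) = bilinear k0 k1 k2 k3 (elem_map e xi).
  by move=> ?; apply: uE; exists xi.
have vF xi : Omega_closed xi -> v (elem_map e xi) = bilinear l0 l1 l2 l3 (elem_map e xi).
  by move=> ?; apply: vE; exists xi.
rewrite /edge_form /= !uF ?vF; try exact: in01.
rewrite /elem_quad ref_quadE/= !tr; try exact: in01.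
rewrite /bilinear /P /elem_map /mesh_size /wH /wV /wD /wA /=.
by field.
Qed.

Lemma continuous_withinM (R : realType) (D : set (R * R)) (f g : R * R -> R) :
  {within D, continuous f} -> {within D, continuous g} ->
  {within D, continuous (fun x => f x * g x)}.
Proof.
move=> /subspace_continuousP cf /subspace_continuousP cg.
by apply/subspace_continuousP => x Dx; apply: cvgM; [exact: cf|exact: cg].
Qed.

Lemma Ah_edge_form (R : realType) (n : nat) (abar : elem n -> 'M[R]_2)
    (c : R * R -> R) (lam : elem n -> R * R) (u v : R * R -> R) :
  (forall e, abar e 1 0 = abar e 0 1) -> {within Omega_closed, continuous c} ->
  Vh n u -> Vh n v ->
  Ah abar c lam u v = \sum_(e : elem n)
    (edge_form (abar e) (lam e) (u \o elem_map e) (v \o elem_map e)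
     + mesh_size n ^+ 2 / 4 * corner_sum ((fun x => c x * u x * v x) \o elem_map e)).
Proof.
move=> sym cc Vu Vv; apply: eq_bigr => e _; rewrite elem_quad_grad// elem_quad_trapezoid//.
by apply: continuous_withinM; [apply: continuous_withinM; [|case: Vu]|case: Vv].
Qed.

(** Everything depends on [T = A 0 0 * lam.2 + A 1 1 * lam.1]. The lower limit gives
    [|A 0 0 - A 1 1| <= T], which is the sign of [wH] and [wV]; the upper limit gives
    [T <= A 0 0 + A 1 1 - 2 * |A 0 1|], which is the sign of [wD] and [wA]. Finally
    [wH + wV = T / 2], positive because both parameters are. *)
Lemma edge_weights_ge0 (R : realType) (A : 'M[R]_2) (lam : R * R) :
  0 < A 0 0 -> 0 < A 1 1 -> 2 * `|A 0 1| < A 0 0 + A 1 1 ->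
  `|A 0 1| <= Num.min (A 0 0) (A 1 1) ->
  (let lo := `|A 0 0 - A 1 1| / (A 0 0 + A 1 1) in
   let hi := 1 - 2 * `|A 0 1| / (A 0 0 + A 1 1) in
   if `|A 0 1| == Num.min (A 0 0) (A 1 1)
   then lam.1 = hi /\ lam.2 = hi
   else lo < lam.1 <= hi /\ lo < lam.2 <= hi) ->
  [/\ 0 <= wH A lam, 0 <= wV A lam, 0 <= wD A lam, 0 <= wA A lam &
      0 < wH A lam + wV A lam].
Proof.
move=> A0 A1 A01 Amin; set S := A 0 0 + A 1 1.
set lo := `|A 0 0 - A 1 1| / S; set hi := 1 - 2 * `|A 0 1| / S => /= lamE.
have S0 : 0 < S by rewrite addr_gt0.
have loS : lo * S = `|A 0 0 - A 1 1| by rewrite mulfVK// gt_eqF.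
have hiS : hi * S = S - 2 * `|A 0 1| by rewrite mulrBl mul1r mulfVK// gt_eqF.
have lo0 : 0 <= lo by rewrite divr_ge0// ltW.
have hi0 : 0 < hi by rewrite -(pmulr_lgt0 _ S0) hiS subr_gt0.
(* [|A 0 0 - A 1 1|] is [S] minus twice the smaller diagonal entry, which is at least [|A 0 1|].
   This covers the degenerate case, where both parameters equal [hi]. *)
have lohi : lo <= hi.
  rewrite -(ler_pM2r S0) loS hiS /S.
  by move: Amin; rewrite le_min => /andP[? ?]; case: (ler0P (A 0 0 - A 1 1)) => ?; lra.
have {lamE} [l1 l2 h1 h2 [p1 p2]] : [/\ lo <= lam.1, lo <= lam.2, lam.1 <= hi, lam.2 <= hi
    & 0 < lam.1 /\ 0 < lam.2].
  move: lamE; case: ifP => _ [].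
    by move=> -> ->; split.
  move=> /andP[l1 h1] /andP[l2 h2]; split=> //; [exact: ltW..|].
  by split; apply: le_lt_trans lo0 _.
have al : `|A 0 0 - A 1 1| <= A 0 0 * lam.2 + A 1 1 * lam.1.
  by rewrite -loS /S mulrDr !(mulrC lo) lerD// ler_pM2l.
have ah : A 0 0 * lam.2 + A 1 1 * lam.1 <= S - 2 * `|A 0 1|.
  by rewrite -hiS /S mulrDr !(mulrC hi) lerD// ler_pM2l.
have nN (t : R) : - t <= `|t| by rewrite -normrN ler_norm.
have := ler_norm (A 0 0 - A 1 1); have := nN (A 0 0 - A 1 1).
have := ler_norm (A 0 1); have := nN (A 0 1).
rewrite /wH /wV /wD /wA; rewrite /S in ah => *.
have q1 : 0 < A 0 0 * lam.2 by rewrite mulr_gt0.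
have q2 : 0 < A 1 1 * lam.1 by rewrite mulr_gt0.
by split; lra.
Qed.

Lemma edge_form_sum (R : realType) (A : 'M[R]_2) (lam : R * R) (I : finType)
    (p : I -> R * R -> R) (q : R * R -> R) :
  \sum_i edge_form A lam (p i) q = edge_form A lam (fun s => \sum_i p i s) q.
Proof.
by rewrite /edge_form !big_split/= -!mulr_sumr !big_split/= -!mulr_suml !sumrB.
Qed.

Lemma elem_map_inj (R : realType) (n : nat) (e : elem n) :
  injective (@elem_map R n e).
Proof.
have n0 : (0 < n)%N by apply: leq_trans (ltn_ord e.1).
have hN0 : mesh_size n != 0 :> R by rewrite invr_eq0 pnatr_eq0 -lt0n.
by move=> [s1 s2] [t1 t2] [] /(mulIf hN0)/addrI -> /(mulIf hN0)/addrI ->.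
Qed.

(** * The entries of the stiffness matrix *)

Section Assembly.
Variables (R : realType) (n : nat) (c : R * R -> R).
Hypothesis c_cont : {within Omega_closed, continuous c}.
Hypothesis c_ge0 : forall x, Omega_closed x -> 0 <= c x.
Variables (Nh Nb : nat) (x : 'I_(Nh + Nb) -> R * R) (phi : 'I_(Nh + Nb) -> R * R -> R).
Hypothesis x_num : vertex_numbering n x.
Hypothesis phi_basis : nodal_basis n x phi.
Variables (abar : elem n -> 'M[R]_2) (lam : elem n -> R * R).
Hypothesis abar_sym : forall e, abar e 1 0 = abar e 0 1.
Hypothesis weights : forall e,
  [/\ 0 <= wH (abar e) (lam e), 0 <= wV (abar e) (lam e),
      0 <= wD (abar e) (lam e), 0 <= wA (abar e) (lam e) &
      0 < wH (abar e) (lam e) + wV (abar e) (lam e)].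

(** Booleans let a corner of [e] be read off as the mesh vertex with indices [e.1 + b1] and
    [e.2 + b2]. *)
Definition corner (s : R * R) : Prop := exists b1 b2 : bool, s = (b1%:R, b2%:R).

Lemma corner00 : corner (0, 0). Proof. by exists false, false. Qed.

Lemma corner01 : corner (0, 1). Proof. by exists false, true. Qed.

Lemma corner10 : corner (1, 0). Proof. by exists true, false. Qed.

Lemma corner11 : corner (1, 1). Proof. by exists true, true. Qed.

Lemma corner_vertex (e : elem n) s : corner s -> exists k, x k = elem_map e s.
Proof.
move=> [b1 [b2 ->]]; have [_ rng _ _] := x_num.
have : range (@mesh_vertex R n) (elem_map e (b1%:R, b2%:R)).
  exists (inord (e.1 + b1), inord (e.2 + b2)) => //.
  rewrite /mesh_vertex /elem_map/= !inordK ?natrD//.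
    by case: b2; rewrite ?addn1 ?addn0 ltnS// ltnW.
  by case: b1; rewrite ?addn1 ?addn0 ltnS// ltnW.
by rewrite -rng => -[k _ <-]; exists k.
Qed.

Lemma phi_corner (e : elem n) s t k :
  corner s -> x k = elem_map e t -> phi k (elem_map e s) = (s == t)%:R.
Proof.
move=> /(corner_vertex e)[l xl] xk; have [_ phiE] := phi_basis.
have [xinj _ _ _] := x_num.
rewrite -xl phiE; congr (nat_of_bool _)%:R; apply/eqP/eqP => [kl|st].
  by apply: (@elem_map_inj R n e); rewrite -xl -xk kl.
by apply: xinj; rewrite xk xl st.
Qed.

Lemma phi_ge0 (e : elem n) s k : corner s -> 0 <= phi k (elem_map e s).
Proof.
by move=> /(corner_vertex e)[l <-]; have [_ ->] := phi_basis; exact: ler0n.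
Qed.

Lemma phi_disjoint (e : elem n) s i j : i != j -> corner s ->
  phi i (elem_map e s) * phi j (elem_map e s) = 0.
Proof.
move=> ij /(corner_vertex e)[l <-]; have [_ phiE] := phi_basis.
rewrite !phiE -natrM mulnb; case: eqP => // <-.
by rewrite eq_sym (negbTE ij).
Qed.

Lemma phi_sum (e : elem n) s : corner s -> \sum_i phi i (elem_map e s) = 1.
Proof.
move=> /(corner_vertex e)[l <-]; have [_ phiE] := phi_basis.
by rewrite (bigD1 l)//= phiE eqxx big1 ?addr0// => i; rewrite phiE => /negbTE ->.
Qed.

Lemma Omega_closed_corner (e : elem n) s : corner s -> Omega_closed (elem_map e s).
Proof.
move=> [b1 [b2 ->]]; apply: (@elem_set_sub R n e); exists (b1%:R, b2%:R) => //.
by split; rewrite /= in_itv/= ler0n lern1 leq_b1.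
Qed.

Let B := stiffness_bar abar c lam phi.

Let term (e : elem n) i j :=
  edge_form (abar e) (lam e) (phi j \o elem_map e) (phi i \o elem_map e)
  + mesh_size n ^+ 2 / 4
    * corner_sum ((fun y => c y * phi j y * phi i y) \o elem_map e).

Lemma stiffness_barE i j : B i j = \sum_e term e (lshift Nb i) j.
Proof. by have [Vphi _] := phi_basis; rewrite mxE Ah_edge_form. Qed.

(** The trapezoid rule samples only vertices, where two distinct basis functions never are both
    nonzero, so the reaction term is diagonal. *)
Lemma term_offdiag e i j : i != j ->
  term e i j = edge_form (abar e) (lam e) (phi j \o elem_map e) (phi i \o elem_map e).
Proof.
move=> ij; rewrite /term /corner_sum /= -!mulrA.
rewrite ![phi j _ * phi i _]phi_disjoint 1?eq_sym// ?mulr0 ?addr0 ?mulr0 ?addr0//.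
all: by [exact: corner00|exact: corner01|exact: corner10|exact: corner11].
Qed.

Lemma term_le0 e i j : i != j -> term e i j <= 0.
Proof.
move=> ij; rewrite term_offdiag//.
(* After expansion the products at a common corner vanish, and the two mixed products enter with a
   minus sign. *)
have d s t : corner s -> corner t ->
    (phi j (elem_map e s) - phi j (elem_map e t)) *
    (phi i (elem_map e s) - phi i (elem_map e t)) <= 0.
  move=> cs ct; rewrite mulrBl !mulrBr opprB.
  rewrite ![phi j (elem_map e ?[u]) * phi i (elem_map e ?u)]phi_disjoint 1?eq_sym//.
  rewrite sub0r addrC add0r -opprD oppr_le0.
  by rewrite addr_ge0// mulr_ge0// phi_ge0.
have [w1 w2 w3 w4 _] := weights e.
have [c00 c01 c10 c11] := And4 corner00 corner01 corner10 corner11.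
have D (u v : R) : u <= 0 -> v <= 0 -> u + v <= 0 by move=> u0 v0; rewrite -(addr0 0) lerD.
by rewrite /edge_form; do ?apply: (D); apply: mulr_ge0_le0 => //; try apply: D; exact: d.
Qed.

Lemma stiffness_bar_offdiag i j : lshift Nb i != j -> B i j <= 0.
Proof. by move=> ij; rewrite stiffness_barE sumr_le0// => e _; exact: term_le0. Qed.

(** At the corners the basis functions add up to 1, so all differences cancel in the row sum and
    only the nonnegative reaction terms remain. *)
Lemma stiffness_bar_rowsum i : 0 <= \sum_j B i j.
Proof.
under eq_bigr do rewrite stiffness_barE.
rewrite exchange_big sumr_ge0//= => e _; rewrite big_split/= edge_form_sum.
have [c00 c01 c10 c11] := And4 corner00 corner01 corner10 corner11.
rewrite [X in X + _](_ : _ = 0); last first.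
  by rewrite /edge_form /= !phi_sum// !subrr !mul0r !(addr0, mulr0).
rewrite add0r sumr_ge0// => j _; rewrite mulr_ge0//.
  by rewrite divr_ge0// exprn_ge0// invr_ge0.
by rewrite /corner_sum/= !addr_ge0// mulr_ge0 ?phi_ge0// mulr_ge0 ?phi_ge0// c_ge0//;
  exact: Omega_closed_corner.
Qed.

(** Both grid indices of an interior vertex are below [n], so they also index an element, whose
    south-west corner is that vertex. *)
Lemma north_east_elem (i : 'I_Nh) : exists e : elem n, x (lshift Nb i) = elem_map e (0, 0).
Proof.
have [_ rng + _] := x_num; move=> /(_ i).
have : range x (x (lshift Nb i)) by exists (lshift Nb i).
rewrite rng => -[[p q] _ <-] [/=]; rewrite !in_itv/=.
have lt_n (k : nat) : 0 < k%:R * (mesh_size n : R) < 1 -> (k < n)%N.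
  (* For [n = 0] the mesh size is [0^-1 = 0], which contradicts the strict lower bound. *)
  have [->|n0] := posnP n; first by rewrite /mesh_size invr0 mulr0 ltxx.
  by rewrite /mesh_size ltr_pdivrMr ?ltr0n// mul1r ltr_nat => /andP[].
move=> p01 q01.
by exists (Ordinal (lt_n _ p01), Ordinal (lt_n _ q01)); rewrite /elem_map /mesh_vertex /= !addr0.
Qed.

(* The element to the north-east of an interior vertex couples it strictly to
   its eastern or to its northern neighbour, because wH + wV > 0. *)
Lemma stiffness_bar_potential i :
  exists2 j, B i j < 0 & (x (lshift Nb i)).1 + (x (lshift Nb i)).2 < (x j).1 + (x j).2.
Proof.
have [e xi] := north_east_elem i.
have n0 : (0 < n)%N by apply: leq_trans (ltn_ord e.1).
have h0 : 0 < mesh_size n :> R by rewrite invr_gt0 ltr0n.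
have [c00 c01 c10 c11] := And4 corner00 corner01 corner10 corner11.
have neq j : (x (lshift Nb i)).1 + (x (lshift Nb i)).2 < (x j).1 + (x j).2 ->
    lshift Nb i != j.
  by apply: contraTneq => ->; rewrite ltxx.
(* One strictly negative element contribution is enough, since no other element contributes a
   positive amount. *)
suff [j tj xj] : exists2 j, term e (lshift Nb i) j < 0 &
    (x (lshift Nb i)).1 + (x (lshift Nb i)).2 < (x j).1 + (x j).2.
  exists j => //; rewrite stiffness_barE (bigD1 e)//= ltr_wnDr//.
  by rewrite sumr_le0// => e' _; apply: term_le0; exact: neq.
have [wH0 wV0 _ _ wHV] := weights e.
have [kE xE] := corner_vertex e c10; have [kN xN] := corner_vertex e c01.
(* The contribution of [e] is [- wH] for the eastern neighbour and [- wV] for the northern one; if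
   [wH] is not positive, [wV] is. *)
have [wHp|wHn] := ltP 0 (wH (abar e) (lam e)).
  have lt : (x (lshift Nb i)).1 + (x (lshift Nb i)).2 < (x kE).1 + (x kE).2.
    by rewrite xi xE /elem_map/=; nra.
  exists kE => //; rewrite term_offdiag ?neq// /edge_form /=.
  rewrite !(phi_corner _ xi)// !(phi_corner _ xE)// !xpair_eqE ?eqxx ?oner_eq0
    ![0 == 1]eq_sym ?oner_eq0 /=.
  by lra.
have lt : (x (lshift Nb i)).1 + (x (lshift Nb i)).2 < (x kN).1 + (x kN).2.
  by rewrite xi xN /elem_map/=; nra.
exists kN => //; rewrite term_offdiag ?neq// /edge_form /=.
rewrite !(phi_corner _ xi)// !(phi_corner _ xN)// !xpair_eqE ?eqxx ?oner_eq0
    ![0 == 1]eq_sym ?oner_eq0 /=.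
by lra.
Qed.

(** The element north-east of the vertex contributes a positive amount through its south-west
    corner, where the basis function is 1; all other contributions are nonnegative. *)
Lemma lumped_mass_gt0 i :
  0 < \sum_(e : elem n) elem_quad e (1, 1) (phi (lshift Nb i)).
Proof.
have [e xi] := north_east_elem i.
have n0 : (0 < n)%N by apply: leq_trans (ltn_ord e.1).
have h0 : 0 < mesh_size n :> R by rewrite invr_gt0 ltr0n.
have [c00 c01 c10 c11] := And4 corner00 corner01 corner10 corner11.
have cphi : {within Omega_closed, continuous (phi (lshift Nb i))}.
  by have [/(_ (lshift Nb i))[]] := phi_basis.
have nonneg (e' : elem n) : 0 <= elem_quad e' (1, 1) (phi (lshift Nb i)).
  rewrite elem_quad_trapezoid// mulr_ge0//.
    by rewrite divr_ge0// exprn_ge0// ltW.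
  by rewrite /corner_sum /= !addr_ge0 ?phi_ge0.
rewrite (bigD1 e)//= ltr_wpDr//; first by rewrite sumr_ge0.
rewrite elem_quad_trapezoid// mulr_gt0//; first by rewrite divr_gt0// exprn_gt0.
rewrite /corner_sum /= (phi_corner c00 xi) eqxx -!addrA.
by rewrite ltr_wpDr ?addr_ge0 ?phi_ge0.
Qed.

End Assembly.

Theorem theorem3p3 (R : realType) (n : nat) (n_gt0 : (0 < n)%N)
  (a : R * R -> 'M[R]_2) (c : R * R -> R)
  (a_cont : {within Omega_closed, continuous a})
  (c_cont : {within Omega_closed, continuous c})
  (a_sym : forall x, Omega_closed x -> (a x)^T = a x)
  (a_posdef : unif_posdef a)
  (c_ge0 : forall x, Omega_closed x -> 0 <= c x)
  (Nh Nb : nat) (Nh_gt0 : (0 < Nh)%N)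
  (x : 'I_(Nh + Nb) -> R * R) (x_num : vertex_numbering n x)
  (phi : 'I_(Nh + Nb) -> R * R -> R) (phi_basis : nodal_basis n x phi)
  (abar : elem n -> 'M[R]_2)
  (abar_def : forall e, abar e = elem_average a e \/ abar e = a (elem_center e))
  (abar_le : forall e, `|abar e 0 1| <= Num.min (abar e 0 0) (abar e 1 1))
  (lam : elem n -> R * R)
  (lam_def : forall e,
    let lo := `|abar e 0 0 - abar e 1 1| / (abar e 0 0 + abar e 1 1) in
    let hi := 1 - 2 * `|abar e 0 1| / (abar e 0 0 + abar e 1 1) in
    if `|abar e 0 1| == Num.min (abar e 0 0) (abar e 1 1)
    then (lam e).1 = hi /\ (lam e).2 = hi
    else lo < (lam e).1 <= hi /\ lo < (lam e).2 <= hi) :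
  [/\ nonsingular_Mmatrix (stiffness abar c lam phi),
      nonsingular_Mmatrix (Lbar abar c lam phi) &
      discrete_max_principle (Lbar abar c lam phi)].
Proof.
have coeff e := elem_coeff_form a_cont a_sym a_posdef (abar_def e).
have abar_sym e : abar e 1 0 = abar e 0 1 by have [] := coeff e.
have weights e : [/\ 0 <= wH (abar e) (lam e), 0 <= wV (abar e) (lam e),
    0 <= wD (abar e) (lam e), 0 <= wA (abar e) (lam e) &
    0 < wH (abar e) (lam e) + wV (abar e) (lam e)].
  by have [_ a00 a11 a01] := coeff e;
    exact: (edge_weights_ge0 a00 a11 a01 (abar_le e) (lam_def e)).
(* [d] is the diagonal of [lumped_mass], so that [Lbar] unfolds to the scaled matrix treated
   above. *)
pose d : 'rV[R]_Nh := \row_i \sum_(e : elem n) elem_quad e (1, 1) (phi (lshift Nb i)).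
have d_gt0 i : 0 < d 0 i.
  by rewrite mxE; exact: lumped_mass_gt0 x_num phi_basis i.
have Boff := stiffness_bar_offdiag c_cont x_num phi_basis abar_sym weights.
have Bsum := stiffness_bar_rowsum c_cont c_ge0 x_num phi_basis lam abar_sym.
pose r k : R := (x k).1 + (x k).2.
have Bpot : forall i, exists2 j, stiffness_bar abar c lam phi i j < 0
    & r (lshift Nb i) < r j :=
  stiffness_bar_potential c_cont x_num phi_basis abar_sym weights.
split.
- rewrite (_ : stiffness _ _ _ _ = lsubmx (stiffness_bar abar c lam phi)).
    exact: (Mmatrix_lsubmx d_gt0 Boff Bsum Bpot).
  by apply/matrixP => i j; rewrite !mxE.
- exact: (Mmatrix_scaled d_gt0 Boff Bsum Bpot).
- exact: (discrete_max_principle_scaled d_gt0 Boff Bsum Bpot Nh_gt0).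
Qed.
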